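(* Let $\alpha$ be an infinite ordinal. Then (1) $WSA_\alpha=SA_\alpha$; and (2) $SA_\alpha$ has the superamalgamation property.
   Context: For distinct $i,j\in\alpha$, $[i,j]$ is the transposition of $\alpha$ swapping $i$ and $j$, and $[i|j]$ is the map $\alpha\to\alpha$ sending $i$ to $j$ and fixing everything else. ${}^\alpha\alpha^{(Id)}=\{s\in{}^\alpha\alpha:|\{i\in\alpha:s_i\ne i\}|<\omega\}$. A set $V$ of $\alpha$-sequences is locally square if $s\circ[i|j],\,s\circ[i,j]\in V$ for all $s\in V$ and $i\neq j\in\alpha$; then $\wp(V)=\langle\mathcal P(V);\cap,\sim,S^i_j,S_{ij}\rangle_{i\ne j\in\alpha}$ with $\sim$ complement in $V$, $S^i_j(X)=\{q\in V:q\circ[i|j]\in X\}$ and $S_{ij}(X)=\{q\in V:q\circ[i,j]\in X\}$. $WSA_\alpha$ is the variety generated by all $\wp(V)$ with $V\subseteq{}^\alpha\alpha^{(Id)}$ locally square. For finite $n\geq 2$, $\Sigma_n$ is the following finite set of equations in the type $\{\cdot,-,s^i_j,s_{ij}\}_{i\ne j\in n}$: (a) the Boolean algebra axioms; (b) each $s_{ij}$ and each $s^i_j$ is a Boolean endomorphism; (c) for a fixed finite presentation of the monoid ${}^nn$ (all maps $n\to n$ under composition) in the generators $[i,j],[i|j]$, all equations $s_{g_1}\cdots s_{g_m}x=s_{h_1}\cdots s_{h_k}x$ for the defining relations $g_1\circ\cdots\circ g_m=h_1\circ\cdots\circ h_k$, where $s_{[i,j]}=s_{ij}$, $s_{[i|j]}=s^i_j$.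 $\Sigma_\alpha$ is the set of all equations in the type $\{\cdot,-,s^i_j,s_{ij}\}_{i\neq j\in\alpha}$ obtained from equations in $\Sigma_n$, $2\le n<\omega$, by replacing the indices along an injection $\rho:n\to\alpha$. $SA_\alpha=\mathbf{Mod}(\Sigma_\alpha)$. A class $K$ of algebras with Boolean reducts has the superamalgamation property if for all $\mathfrak A_0,\mathfrak A_1,\mathfrak A_2\in K$ and embeddings $i_1:\mathfrak A_0\to\mathfrak A_1$, $i_2:\mathfrak A_0\to\mathfrak A_2$ there are $\mathfrak D\in K$ and embeddings $m_1:\mathfrak A_1\to\mathfrak D$, $m_2:\mathfrak A_2\to\mathfrak D$ with $m_1\circ i_1=m_2\circ i_2$, and whenever $\{j,k\}=\{1,2\}$, $x\in\mathfrak A_j$, $y\in\mathfrak A_k$ and $m_j(x)\le m_k(y)$, there is $z\in\mathfrak A_0$ with $x\le i_j(z)$ and $i_k(z)\le y$. *)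

(* Defs.v *)
From Stdlib Require List.
From HB Require Import structures.
From mathcomp Require Import all_boot all_order.
From mathcomp Require Import boolp classical_sets functions cardinality.

Set Implicit Arguments.
Unset Strict Implicit.
Unset Printing Implicit Defensive.

Local Open Scope classical_set_scope.

Definition distinct_pair (I : eqType) := {p : I * I | p.1 != p.2}.

(* [Swap] of (i, j) denotes the transposition [i,j]; [Repl] of (i, j) denotes
   the replacement [i|j], which sends i to j. *)
Inductive gen (I : eqType) : Type :=
  | Swap of distinct_pair I
  | Repl of distinct_pair I.

Section GenEq.
Variable I : eqType.

Definition gen_sum (g : gen I) : distinct_pair I + distinct_pair I :=
  match g with Swap p => inl p | Repl p => inr p end.

Definition sum_gen (p : distinct_pair I + distinct_pair I) : gen I :=
  match p with inl p => Swap p | inr p => Repl p end.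

Lemma gen_sumK : cancel gen_sum sum_gen.
Proof. by case. Qed.

HB.instance Definition _ := Equality.copy (gen I) (can_type gen_sumK).

End GenEq.

Definition gen_fun (I : eqType) (g : gen I) : I -> I :=
  match g with
  | Swap p => fun k => if k == (val p).1 then (val p).2
                       else if k == (val p).2 then (val p).1 else k
  | Repl p => fun k => if k == (val p).1 then (val p).2 else k
  end.

Lemma distinct_pair_map_proof (I J : eqType) (rho : I -> J)
  (rho_inj : injective rho) (p : distinct_pair I) :
  rho (val p).1 != rho (val p).2.
Proof. by rewrite (inj_eq rho_inj); exact: (valP p). Qed.

Definition distinct_pair_map (I J : eqType) (rho : I -> J)
    (rho_inj : injective rho) (p : distinct_pair I) : distinct_pair J :=
  exist (fun q : J * J => q.1 != q.2) (rho (val p).1, rho (val p).2)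
    (distinct_pair_map_proof rho_inj p).

Definition gen_map (I J : eqType) (rho : I -> J) (rho_inj : injective rho)
    (g : gen I) : gen J :=
  match g with
  | Swap p => Swap (distinct_pair_map rho_inj p)
  | Repl p => Repl (distinct_pair_map rho_inj p)
  end.

Definition word (I : eqType) := seq (gen I).

(* The word g_1 ... g_m denotes g_1 o ... o g_m, so g_m is applied first. *)
Definition word_fun (I : eqType) (w : word I) : I -> I :=
  foldr (fun g f => gen_fun g \o f) id w.

Inductive word_congr (I : eqType) (R : seq (word I * word I)) :
    word I -> word I -> Prop :=
  | WCRefl u : word_congr R u u
  | WCSym u v : word_congr R u v -> word_congr R v u
  | WCTrans u v w : word_congr R u v -> word_congr R v w -> word_congr R u w
  | WCRel a b u v : (u, v) \in R ->
      word_congr R (a ++ u ++ b) (a ++ v ++ b).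

(* The canonical morphism from the free monoid on [gen I] to the monoid of all
   maps I -> I is onto, and its kernel is the congruence generated by R. *)
Definition presents (I : eqType) (R : seq (word I * word I)) : Prop :=
  (forall f : I -> I, exists w, word_fun w =1 f) /\
  (forall u v, word_congr R u v <-> word_fun u =1 word_fun v).

(* As the type has no constants, nonemptiness of the universe is required
   explicitly. *)
Record algebra (I : eqType) := Algebra {
  carrier :> Type;
  carrier_inhabited : inhabited carrier;
  meet : carrier -> carrier -> carrier;
  compl : carrier -> carrier;
  sub : gen I -> carrier -> carrier
}.

Definition leA (I : eqType) (A : algebra I) (x y : A) : Prop := meet x y = x.

Definition is_hom (I : eqType) (A B : algebra I) (f : A -> B) : Prop :=
  [/\ forall x y, f (meet x y) = meet (f x) (f y),
      forall x, f (compl x) = compl (f x) &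
      forall g x, f (sub g x) = sub g (f x)].

Definition is_embedding (I : eqType) (A B : algebra I) (f : A -> B) : Prop :=
  is_hom f /\ injective f.

Lemma prod_inhabited (T : Type) (U : T -> Type) :
  (forall t, inhabited (U t)) -> inhabited (forall t, U t).
Proof. by move=> h; exists => t; exact: inhabited_witness (h t). Qed.

Definition prod_algebra (I : eqType) (T : Type) (A : T -> algebra I) :
    algebra I :=
  {| carrier := forall t, A t;
     carrier_inhabited := prod_inhabited (fun t => carrier_inhabited (A t));
     meet := fun x y t => meet (x t) (y t);
     compl := fun x t => compl (x t);
     sub := fun g x t => sub g (x t) |}.

Inductive term (I : eqType) : Type :=
  | Var of nat
  | Meet of term I & term I
  | Compl of term I
  | Sub of gen I & term I.

Arguments Var {I}.

Definition Join (I : eqType) (s t : term I) : term I :=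
  Compl (Meet (Compl s) (Compl t)).

Definition equation (I : eqType) := (term I * term I)%type.

Fixpoint eval (I : eqType) (A : algebra I) (v : nat -> A) (t : term I) : A :=
  match t with
  | Var k => v k
  | Meet s t => meet (eval v s) (eval v t)
  | Compl s => compl (eval v s)
  | Sub g s => sub g (eval v s)
  end.

Definition satisfies (I : eqType) (A : algebra I) (e : equation I) : Prop :=
  forall v : nat -> A, eval v e.1 = eval v e.2.

Fixpoint term_map (I J : eqType) (rho : I -> J) (rho_inj : injective rho)
    (t : term I) : term J :=
  match t with
  | Var k => Var k
  | Meet s t => Meet (term_map rho_inj s) (term_map rho_inj t)
  | Compl s => Compl (term_map rho_inj s)
  | Sub g s => Sub (gen_map rho_inj g) (term_map rho_inj s)
  end.

Definition equation_map (I J : eqType) (rho : I -> J) (rho_inj : injective rho)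
    (e : equation I) : equation J :=
  (term_map rho_inj e.1, term_map rho_inj e.2).

Definition word_term (I : eqType) (w : word I) (t : term I) : term I :=
  foldr (@Sub I) t w.

(* The axioms of complemented distributive lattices, with the join x + y
   written -(-x . -y), the zero x . -x and the unit x + -x. *)
Definition BA_axioms (I : eqType) : seq (equation I) :=
  let x := Var 0 in let y := Var 1 in let z := Var 2 in
  [:: (Meet x y, Meet y x);
      (Join x y, Join y x);
      (Meet x (Meet y z), Meet (Meet x y) z);
      (Join x (Join y z), Join (Join x y) z);
      (Meet x (Join x y), x);
      (Join x (Meet x y), x);
      (Meet x (Join y z), Join (Meet x y) (Meet x z));
      (Join x (Meet y z), Meet (Join x y) (Join x z));
      (Meet y (Join x (Compl x)), y);
      (Join y (Meet x (Compl x)), y)].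

Inductive Sigma_fin (n : nat) (R : seq (word 'I_n * word 'I_n)) :
    equation 'I_n -> Prop :=
  | SigmaBA e : List.In e (BA_axioms 'I_n) -> Sigma_fin R e
  | SigmaMeet g : Sigma_fin R
      (Sub g (Meet (Var 0) (Var 1)), Meet (Sub g (Var 0)) (Sub g (Var 1)))
  | SigmaCompl g : Sigma_fin R
      (Sub g (Compl (Var 0)), Compl (Sub g (Var 0)))
  | SigmaRel u v : (u, v) \in R ->
      Sigma_fin R (word_term u (Var 0), word_term v (Var 0)).

Inductive Sigma (alpha : eqType)
    (R : forall n, seq (word 'I_n * word 'I_n)) : equation alpha -> Prop :=
  | SigmaInj n (rho : 'I_n -> alpha) (rho_inj : injective rho)
      (e : equation 'I_n) :
      (2 <= n)%N -> Sigma_fin (R n) e -> Sigma R (equation_map rho_inj e).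

Definition SA (alpha : eqType) (R : forall n, seq (word 'I_n * word 'I_n))
    (A : algebra alpha) : Prop :=
  forall e, Sigma R e -> satisfies A e.

Definition weak_space (alpha : eqType) : set (alpha -> alpha) :=
  [set s | finite_set [set i | s i <> i]].

Definition locally_square (alpha : eqType) (V : set (alpha -> alpha)) : Prop :=
  forall s, V s -> forall g : gen alpha, V (s \o gen_fun g).

Section PowerAlgebra.
Variables (alpha : eqType) (V : set (alpha -> alpha)).

Definition powerset_of := {X : set (alpha -> alpha) | X `<=` V}.

Lemma power_meet_proof (X Y : powerset_of) : sval X `&` sval Y `<=` V.
Proof. by move=> s [Xs _]; exact: (proj2_sig X). Qed.

Lemma power_compl_proof (X : powerset_of) : V `\` sval X `<=` V.
Proof. by move=> s []. Qed.

Lemma power_sub_proof (g : gen alpha) (X : powerset_of) :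
  [set q | V q /\ sval X (q \o gen_fun g)] `<=` V.
Proof. by move=> s []. Qed.

Definition power_elt (X : set (alpha -> alpha)) (XV : X `<=` V) :
    powerset_of := exist _ X XV.

Definition power_algebra : algebra alpha :=
  {| carrier := powerset_of;
     carrier_inhabited := inhabits (power_elt (@subset_refl _ V));
     meet := fun X Y => power_elt (@power_meet_proof X Y);
     compl := fun X => power_elt (@power_compl_proof X);
     sub := fun g X => power_elt (@power_sub_proof g X) |}.

End PowerAlgebra.

(* Classes of algebras are plain predicates: [set (algebra I)] would force the
   universe of carriers strictly below the one that [powerset_of] lives in. *)
Definition variety (I : eqType) (K : algebra I -> Prop) : Prop :=
  [/\ forall (A B : algebra I) (f : A -> B),
        is_hom f -> (forall b, exists a, f a = b) -> K A -> K B,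
      forall (A B : algebra I) (f : A -> B), is_embedding f -> K B -> K A &
      forall (T : Type) (A : T -> algebra I),
        (forall t, K (A t)) -> K (prod_algebra A)].

Definition generated_variety (I : eqType) (K : algebra I -> Prop)
    (A : algebra I) : Prop :=
  forall L : algebra I -> Prop,
    variety L -> (forall B, K B -> L B) -> L A.

Definition WSA (alpha : eqType) : algebra alpha -> Prop :=
  generated_variety (fun A => exists V : set (alpha -> alpha),
    [/\ V `<=` @weak_space alpha, locally_square V & A = power_algebra V]).

Definition superamalgamation (I : eqType) (K : algebra I -> Prop) : Prop :=
  forall (A0 A1 A2 : algebra I) (i1 : A0 -> A1) (i2 : A0 -> A2),
    K A0 -> K A1 -> K A2 -> is_embedding i1 -> is_embedding i2 ->
    exists (D : algebra I) (m1 : A1 -> D) (m2 : A2 -> D),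
      [/\ K D, is_embedding m1, is_embedding m2 &
          forall a, m1 (i1 a) = m2 (i2 a)] /\
      (forall x y, leA (m1 x) (m2 y) -> exists z, leA x (i1 z) /\ leA (i2 z) y) /\
      (forall x y, leA (m2 x) (m1 y) -> exists z, leA x (i2 z) /\ leA (i1 z) y).

(* Main.v *)
(* Since [presents] makes words denoting the same finitary map act equally, an
   algebra of [SA] is a Boolean algebra on which the monoid M of finitary maps
   of alpha acts by endomorphisms. An ultrafilter F of such an algebra A yields
   a homomorphism a |-> {q in M | s_q a in F} from A to the power algebra of M,
   and these homomorphisms separate the elements of A; hence A embeds in a power
   of that algebra. For superamalgamation, M acts on the pairs of ultrafilters
   of A1 and A2 with the same trace on A0, and the amalgam is the algebra of all
   sets of such pairs. *)

From Stdlib Require List.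
Require Import Defs.
From mathcomp Require Import all_boot all_order.
From mathcomp Require Import boolp classical_sets functions cardinality.

Set Implicit Arguments.
Unset Strict Implicit.
Unset Printing Implicit Defensive.

Local Open Scope classical_set_scope.

(** * Words of generators, the maps they denote and their action on an algebra *)

Definition gen_pair (I : eqType) (g : gen I) : distinct_pair I :=
  match g with Swap p | Repl p => p end.

Definition word_indices (I : eqType) (w : word I) : seq I :=
  flatten [seq [:: (val (gen_pair g)).1; (val (gen_pair g)).2] | g <- w].

Definition act (I : eqType) (A : algebra I) (w : word I) (x : A) : A :=
  foldr (@sub I A) x w.

Lemma act_cat (I : eqType) (A : algebra I) (u v : word I) (x : A) :
  act (u ++ v) x = act u (act v x).
Proof. by rewrite /act foldr_cat. Qed.

Lemma word_fun_cat (I : eqType) (u v : word I) :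
  word_fun (u ++ v) =1 word_fun u \o word_fun v.
Proof. by elim: u => [|g u IHu] i //=; rewrite IHu. Qed.

Lemma word_congr_word_fun (n : nat) (R : seq (word 'I_n * word 'I_n))
    (u v : word 'I_n) :
  presents R -> (u, v) \in R -> word_fun u =1 word_fun v.
Proof.
move=> [_ hR] uvR; apply/hR.
by have := WCRel [::] [::] uvR; rewrite !cats0.
Qed.

(** * Transport of words and terms along an injection of index sets *)

Section Reindexing.
Variables (I J : eqType) (rho : I -> J) (rho_inj : injective rho).

Lemma gen_fun_map (g : gen I) (i : I) :
  gen_fun (gen_map rho_inj g) (rho i) = rho (gen_fun g i).
Proof.
by case: g => p /=; rewrite !(inj_eq rho_inj); case: ifP => // _; case: ifP.
Qed.

Lemma word_fun_map (w : word I) (i : I) :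
  word_fun (map (gen_map rho_inj) w) (rho i) = rho (word_fun w i).
Proof. by elim: w => //= g w ->; rewrite gen_fun_map. Qed.

Lemma word_fun_map_out (w : word I) (j : J) :
  (forall i, rho i != j) -> word_fun (map (gen_map rho_inj) w) j = j.
Proof.
move=> jN; elim: w => //= g w ->.
by case: g => p /=; rewrite ![j == _]eq_sym !(negbTE (jN _)).
Qed.

(** On the range of [rho] both sides are conjugate to the original maps; off it, reindexed words fix
    every point. *)
Lemma eq_word_fun_map (u v : word I) : word_fun u =1 word_fun v ->
  word_fun (map (gen_map rho_inj) u) =1 word_fun (map (gen_map rho_inj) v).
Proof.
move=> uv j; have [[i <-]|jN] := pselect (exists i, rho i = j).
  by rewrite !word_fun_map uv.
by rewrite !word_fun_map_out // => i; apply/eqP => ij; apply: jN; exists i.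
Qed.

Lemma BA_axioms_map :
  BA_axioms J = List.map (equation_map rho_inj) (BA_axioms I).
Proof. by []. Qed.

Lemma gen_lift (g : gen J) :
  (exists i, rho i = (val (gen_pair g)).1) ->
  (exists i, rho i = (val (gen_pair g)).2) ->
  exists g', gen_map rho_inj g' = g.
Proof.
move=> [i hi] [j hj].
have ij : i != j.
  by apply/eqP => e; have := valP (gen_pair g); rewrite /= -hi -hj e eqxx.
case: g hi hj => -[[a b] ab] /= hi hj.
  exists (Swap (exist (fun q : I * I => q.1 != q.2) (i, j) ij)) => /=.
  by congr Swap; apply: val_inj; rewrite /= hi hj.
exists (Repl (exist (fun q : I * I => q.1 != q.2) (i, j) ij)) => /=.
by congr Repl; apply: val_inj; rewrite /= hi hj.
Qed.

Lemma word_lift (w : word J) :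
  (forall j, j \in word_indices w -> exists i, rho i = j) ->
  exists w', map (gen_map rho_inj) w' = w.
Proof.
elim: w => [|g w IHw] hw; first by exists [::].
have [|w' ew] := IHw.
  by move=> j jw; apply: hw; rewrite /word_indices /= !inE jw !orbT.
have [||g' eg] := @gen_lift g.
- by apply: hw; rewrite /word_indices /= !inE eqxx.
- by apply: hw; rewrite /word_indices /= !inE eqxx orbT.
by exists (g' :: w'); rewrite /= ew eg.
Qed.

Lemma eval_word_term_map (A : algebra J) (v : nat -> A) (w : word I)
    (t : term I) :
  eval v (term_map rho_inj (word_term w t)) =
  act (map (gen_map rho_inj) w) (eval v (term_map rho_inj t)).
Proof. by elim: w => //= g w ->. Qed.

End Reindexing.

(** * A presentation-free form of the axioms *)

Record is_SA (I : eqType) (A : algebra I) : Prop := IsSA {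
  SA_BA : forall e, List.In e (BA_axioms I) -> satisfies A e;
  SA_meet : forall g (x y : A), sub g (meet x y) = meet (sub g x) (sub g y);
  SA_compl : forall g (x : A), sub g (compl x) = compl (sub g x);
  SA_act : forall u v, word_fun u =1 word_fun v ->
    forall x : A, act u x = act v x
}.

Section Presentations.
Variables (I : eqType) (R : forall n, seq (word 'I_n * word 'I_n)).
Arguments R : clear implicits.
Hypothesis R_presents : forall n, (2 <= n)%N -> presents (R n).

Lemma is_SA_SA (A : algebra I) : is_SA A -> SA R A.
Proof.
case=> hBA hmeet hcompl hact _ [n rho rho_inj e n2 he].
case: he => [{}e he|g|g|u v uv].
- by apply: hBA; rewrite (BA_axioms_map rho_inj); exact: List.in_map.
- by move=> v /=; rewrite hmeet.
- by move=> v /=; rewrite hcompl.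
move=> w; rewrite /= !eval_word_term_map; apply: hact.
by apply/eq_word_fun_map/(word_congr_word_fun (R_presents n2)).
Qed.

(** Induction on the congruence. For a relation in context, the right context is absorbed into the
    value of the variable and the left one acts on both sides. *)
Lemma SA_word_congr (A : algebra I) (n : nat) (rho : 'I_n -> I)
    (rho_inj : injective rho) (u v : word 'I_n) :
  (2 <= n)%N -> SA R A -> word_congr (R n) u v ->
  forall x : A,
    act (map (gen_map rho_inj) u) x = act (map (gen_map rho_inj) v) x.
Proof.
move=> n2 hA; elim=> {u v} [//|u v _ IH|u v w _ IH1 _ IH2|a b u v uv] x.
- by rewrite IH.
- by rewrite IH1.
rewrite !map_cat !act_cat; congr act.
have := hA _ (SigmaInj rho_inj n2 (SigmaRel uv))
  (fun=> act (map (gen_map rho_inj) b) x).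
by rewrite /= !eval_word_term_map.
Qed.

Variables (a b : I) (ab : a != b).

Lemma seq_reindexing (s : seq I) : exists n (rho : 'I_n -> I),
  [/\ (2 <= n)%N, injective rho & forall j, j \in s -> exists i, rho i = j].
Proof.
(* Adding the distinct indices [a] and [b] guarantees [2 <= n], even for empty [s]. *)
pose t := undup (a :: b :: s).
exists (size t), (tnth (in_tuple t)); split.
- apply: (@uniq_leq_size _ [:: a; b]); first by rewrite /= inE ab.
  by move=> j; rewrite mem_undup !inE orbA => ->.
- by apply/tuple_uniqP; exact: undup_uniq.
move=> j js; suff /tnthP [i ->] : j \in in_tuple t by exists i.
by rewrite mem_undup !inE js !orbT.
Qed.

(** Each instance mentions finitely many indices, so it is the image of an instance over some
    ['I_n]. For words, injectivity of [rho] pulls equality of maps back to ['I_n], where the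
    presentation turns it into a congruence. *)
Lemma SA_is_SA (A : algebra I) : SA R A -> is_SA A.
Proof.
move=> hA; split.
- have [n [rho [n2 rho_inj _]]] := seq_reindexing [::].
  move=> _ /[!BA_axioms_map rho_inj] /List.in_map_iff [e [<- he]].
  exact: hA (SigmaInj rho_inj n2 (SigmaBA (R n) he)).
- move=> g x y; have [n [rho [n2 rho_inj hs]]] :=
    seq_reindexing (word_indices [:: g]).
  have [[|g' []] //= [eg]] := word_lift rho_inj hs.
  have := hA _ (SigmaInj rho_inj n2 (SigmaMeet (R n) g'))
    (fun k => if k is 0 then x else y).
  by rewrite /= eg.
- move=> g x; have [n [rho [n2 rho_inj hs]]] :=
    seq_reindexing (word_indices [:: g]).
  have [[|g' []] //= [eg]] := word_lift rho_inj hs.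
  have := hA _ (SigmaInj rho_inj n2 (SigmaCompl (R n) g')) (fun=> x).
  by rewrite /= eg.
move=> u v uv x; have [n [rho [n2 rho_inj hs]]] :=
  seq_reindexing (word_indices u ++ word_indices v).
have [|u' eu] := @word_lift _ _ _ rho_inj u.
  by move=> j ju; apply: hs; rewrite mem_cat ju.
have [|v' ev] := @word_lift _ _ _ rho_inj v.
  by move=> j jv; apply: hs; rewrite mem_cat jv orbT.
rewrite -eu -ev; apply: SA_word_congr => //.
apply/(R_presents n2).2 => i; apply: (rho_inj).
by rewrite -!(word_fun_map rho_inj) eu ev.
Qed.

End Presentations.

(** * Closure properties, and algebras of sets of points *)

Lemma variety_SA (I : eqType) (R : forall n, seq (word 'I_n * word 'I_n)) :
  variety (@SA I R).
Proof.
have hom_eval (A B : algebra I) (f : A -> B) v t : is_hom f ->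
    f (eval v t) = eval (f \o v) t.
  by case=> fm fc fs; elim: t => //= [s IHs t IHt|s IHs|g s IHs];
    rewrite ?fm ?fc ?fs ?IHs ?IHt.
split.
- move=> A B f fh fsurj hA e he v.
  have [w ew] := choice (fun k => fsurj (v k)).
  have -> : v = f \o w by apply/funext => k; rewrite /= ew.
  by rewrite -!hom_eval // (hA e he).
- by move=> A B f [fh finj] hB e he v; apply: finj; rewrite !hom_eval // (hB e he).
move=> T A hA e he v; apply: functional_extensionality_dep => t.
have ph : is_hom (fun x : prod_algebra A => x t) by [].
by rewrite !(hom_eval _ _ (fun x : prod_algebra A => x t)) // (hA t e he).
Qed.

(** Here [h] represents [A] by subsets of [Y], and [r] lets generators act on [Y] from the right;
    the axioms can then be checked point by point. Power algebras and the amalgam are both handled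
    this way. *)
Lemma is_SA_points (I : eqType) (A : algebra I) (Y : Type)
    (h : A -> Y -> Prop) (r : Y -> gen I -> Y) :
  injective h ->
  (forall x y p, h (meet x y) p <-> h x p /\ h y p) ->
  (forall x p, h (compl x) p <-> ~ h x p) ->
  (forall g x p, h (sub g x) p <-> h x (r p g)) ->
  (forall u v, word_fun u =1 word_fun v ->
    forall p, foldl r p u = foldl r p v) ->
  is_SA A.
Proof.
move=> h_inj hm hc hs hr.
have h_ext x y : (forall p, h x p <-> h y p) -> x = y.
  by move=> xy; apply/h_inj/funext => p; apply/propext.
have h_act w x p : h (act w x) p <-> h x (foldl r p w).
  by elim: w p => //= g w IHw p; rewrite hs.
split.
- move=> e he v; apply: h_ext => p.
  (* Excluded middle for the three variables at [p] makes every Boolean axiom provable by the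
     intuitionistic [tauto]. *)
  have [h0 h1 h2] := And3 (EM (h (v 0) p)) (EM (h (v 1) p)) (EM (h (v 2) p)).
  move: he; rewrite /BA_axioms /=.
  by do ![case=> [<- /=|]; first by rewrite !(hm, hc); tauto]; case.
- by move=> g x y; apply: h_ext => p; rewrite !(hs, hm).
- by move=> g x; apply: h_ext => p; rewrite !(hs, hc).
by move=> u v uv x; apply: h_ext => p; rewrite !h_act (hr _ _ uv).
Qed.

(** The points are the members of [V], on which generators act by composition on the right; local
    squareness keeps the action inside [V]. *)
Lemma is_SA_power_algebra (I : eqType) (V : set (I -> I)) :
  locally_square V -> is_SA (power_algebra V).
Proof.
move=> hV.
pose r (s : {s | V s}) g : {s | V s} := exist V _ (hV _ (proj2_sig s) g).
apply: (@is_SA_points I (power_algebra V) {s | V s}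
  (fun X s => sval X (sval s)) r) => //.
- move=> [X XV] [Y YV] /= XY; apply: eq_exist; apply/seteqP; split=> s Xs.
    by have /= <- := congr1 (@^~ (exist V s (XV _ Xs))) XY.
  by have /= -> := congr1 (@^~ (exist V s (YV _ Xs))) XY.
- by move=> [X XV] [s sV] /=; split=> [[]|].
- by move=> g [X XV] [s sV] /=; split=> [[]|].
have sval_ext (s t : {s | V s}) : sval s = sval t -> s = t.
  by case: s t => [s sV] [t tV] /= st; exact: eq_exist.
move=> u v uv p; apply: sval_ext.
have hr w s : sval (foldl r s w) = sval s \o word_fun w.
  elim: w s => //= g w IHw s; rewrite IHw /=; exact: compA.
by rewrite !hr; apply/funext => i /=; rewrite uv.
Qed.

(** * Boolean algebra and ultrafilters *)

(** The type has no constants, so the zero is built from a chosen element; under the Boolean axioms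
    the choice is immaterial. *)
Definition bot (I : eqType) (A : algebra I) : A :=
  let a := inhabited_witness (carrier_inhabited A) in meet a (compl a).

(** Ultrafilters as Boolean homomorphisms to truth values; properness and upward closure follow. *)
Definition is_ultra (I : eqType) (A : algebra I) (F : A -> Prop) : Prop :=
  (forall x y, F (meet x y) <-> F x /\ F y) /\
  (forall x, F (compl x) <-> ~ F x).

Section BooleanAlgebra.
Variables (I : eqType) (A : algebra I).
Hypothesis hA : is_SA A.
Implicit Types x y z : A.

Let join x y := compl (meet (compl x) (compl y)).

(** Selects an axiom by its position. The defaults are harmless: a position past the end gives
    [True], and every variable from 2 on is read as [z]. *)
Let BA (k : nat) x y z :
  nth True [seq eval (nth z [:: x; y]) e.1 = eval (nth z [:: x; y]) e.2
           | e <- BA_axioms I] k.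
Proof.
elim: (BA_axioms I) k (SA_BA hA) => [[]//|e l IHl [|k] h] /=.
  by apply: h; left.
by apply: IHl => e' he'; apply: h; right.
Qed.

Lemma meetC x y : meet x y = meet y x. Proof. exact: (BA 0 x y x). Qed.
Lemma meetA x y z : meet x (meet y z) = meet (meet x y) z.
Proof. exact: (BA 2 x y z). Qed.
Let joinK x y : meet x (join x y) = x. Proof. exact: (BA 4 x y x). Qed.
Let meetK x y : join x (meet x y) = x. Proof. exact: (BA 5 x y x). Qed.
Let meet_join x y z : meet x (join y z) = join (meet x y) (meet x z).
Proof. exact: (BA 6 x y z). Qed.
Let meet_top x y : meet y (join x (compl x)) = y.
Proof. exact: (BA 8 x y x). Qed.
Let join_bot x y : join y (meet x (compl x)) = y.
Proof. exact: (BA 9 x y x). Qed.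
Let joinC x y : join x y = join y x. Proof. exact: (BA 1 x y x). Qed.

Lemma meetxx x : meet x x = x.
Proof. by rewrite -{2}(meetK x x) joinK. Qed.

(** The join is defined by De Morgan, so the join of [x] with itself is its double complement. *)
Lemma complK x : compl (compl x) = x.
Proof. by rewrite -{2}(meetK x x) meetxx /join meetxx. Qed.

Lemma meetxN x : meet x (compl x) = bot A.
Proof.
set a := inhabited_witness (carrier_inhabited A).
by rewrite -(join_bot a (meet _ _)) joinC join_bot.
Qed.

Lemma meetxbot x : meet x (bot A) = bot A.
Proof. by rewrite -(meetxN x) meetA meetxx. Qed.

Lemma eq_bot_split x y :
  meet x y = bot A -> meet x (compl y) = bot A -> x = bot A.
Proof.
move=> h1 h2; rewrite -(meet_top y x) meet_join h1 h2.
by rewrite /join meetxx complK.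
Qed.

Lemma leA_bot x y : leA x y <-> meet x (compl y) = bot A.
Proof.
split=> [<-|h]; first by rewrite -meetA meetxN meetxbot.
by rewrite /leA -{2}(meet_top y x) meet_join h -(meetxN x) join_bot.
Qed.

Lemma leA_anti x y : leA x y -> leA y x -> x = y.
Proof. by move=> xy yx; rewrite -xy meetC. Qed.

Lemma leA_meet x y x' y' :
  leA x x' -> leA y y' -> leA (meet x y) (meet x' y').
Proof.
rewrite /leA => xx' yy'; rewrite -[in RHS]xx' -[in RHS]yy' -!meetA.
by congr meet; rewrite !meetA (meetC y).
Qed.

Lemma leA_meetl x y : leA (meet x y) x.
Proof. by rewrite /leA (meetC x) -meetA meetxx. Qed.

Lemma ultra_bot F : is_ultra F -> ~ F (bot A).
Proof. by move=> [Fm Fc]; rewrite /bot Fm Fc => -[]. Qed.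

Lemma ultra_act F w : is_ultra F -> is_ultra (fun x => F (act w x)).
Proof.
move=> [Fm Fc].
have am x y : act w (meet x y) = meet (act w x) (act w y).
  by elim: (w) => //= g w' ->; rewrite (SA_meet hA).
have ac x : act w (compl x) = compl (act w x).
  by elim: (w) => //= g w' ->; rewrite (SA_compl hA).
by split=> [x y|x]; rewrite ?am ?ac.
Qed.

Let filter_base (B : set A) :=
  (forall x y, B x -> B y -> B (meet x y)) /\ ~ B (bot A).

(** Zorn's lemma is applied to the sets [G] for which the union of [B] and [G] is a filter base;
    with [B] built in, the empty chain needs no separate treatment. *)
Lemma ultra_exists (B : set A) (b : A) : B b ->
  (forall x y, B x -> B y -> B (meet x y)) -> ~ B (bot A) ->
  exists2 F, is_ultra F & forall x, B x -> F x.
Proof.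
move=> Bb Bm B0.
have [|G [[Um U0] Gmax]] := @Zorn_bigcup A (fun G => filter_base (B `|` G)).
  move=> C hC totC; split=> [x y|].
    have inC X : C X -> (B `|` X) x -> (B `|` X) y ->
        (B `|` \bigcup_(X in C) X) (meet x y).
      move=> CX Xx Xy.
      by case: ((hC _ CX).1 _ _ Xx Xy) => ?; [left|right; exists X].
    move=> [Bx|[X CX Xx]] [By|[Z CZ Zy]]; first by left; exact: Bm.
    - by apply: (inC Z) => //; [left|right].
    - by apply: (inC X) => //; [right|left].
    have [XZ|ZX] := totC _ _ CX CZ; last by apply: (inC X) => //; right; auto.
    by apply: (inC Z) => //; right; auto.
  by move=> [//|[X CX X0]]; apply: (hC _ CX).2; right.
set U := B `|` G in Um U0.
have Umax (W : set A) : U `<=` W -> filter_base W -> W `<=` U.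
  move=> UW hW; apply: contrapT => WU; apply: (Gmax W); last first.
    by rewrite setUidr // => x Bx; apply: UW; left.
  split; first by move=> x Gx; apply: UW; right.
  by move=> WG; apply: WU => x /WG; right.
have Ub : U b by left.
(* If [x] meets every member of [U], the filter generated by [U] and [x] is proper, so maximality
   puts [x] in [U]. *)
have Umem x : (forall u, U u -> meet u x <> bot A) -> U x.
  move=> hx; apply: (Umax [set y | exists2 u, U u & leA (meet u x) y]).
  - by move=> u Uu; exists u => //; exact: leA_meetl.
  - split=> [y z [u Uu uy] [v Uv vz]|[u Uu /leA_bot]].
      exists (meet u v); first exact: Um.
      suff -> : meet (meet u v) x = meet (meet u x) (meet v x).
        exact: leA_meet.
      by rewrite -!meetA (meetA x) (meetC x) -meetA meetxx.
    have -> : compl (bot A) = join b (compl b).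
      by rewrite /join complK (meetC (compl b)) meetxN.
    by rewrite meet_top; exact: hx.
  by exists b => //; rewrite meetC; exact: leA_meetl.
have Uup x y : U x -> leA x y -> U y.
  move=> Ux xy; apply: Umem => u Uu uy; apply: U0.
  rewrite -(meetxbot x) -uy (meetC u) meetA xy; exact: Um.
have Uex x : ~ U x -> exists2 u, U u & meet u x = bot A.
  move=> Ux; apply: contrapT => h; apply/Ux/Umem => u Uu ux.
  by apply: h; exists u.
exists U; last by left.
split=> [x y|x]; split.
- move=> Uxy; split; first exact: Uup (leA_meetl x y).
  by move: Uxy; rewrite meetC => /Uup; apply; exact: leA_meetl.
- by move=> [Ux Uy]; exact: Um.
- by move=> UNx Ux; apply: U0; rewrite -(meetxN x); exact: Um.
(* If [U] omits both [x] and its complement, members [u] and [v] are disjoint from them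
   respectively; splitting along [x] then makes [meet u v] zero. *)
move=> Ux; apply: contrapT => UNx.
have [u Uu ux] := Uex _ Ux; have [v Uv vx] := Uex _ UNx.
apply: U0; rewrite -(@eq_bot_split (meet u v) x); first exact: Um.
  by rewrite (meetC u) -meetA ux meetxbot.
by rewrite -meetA vx meetxbot.
Qed.

Lemma ultra_separation x y : ~ leA x y -> exists2 F, is_ultra F & F x /\ ~ F y.
Proof.
rewrite leA_bot => xy.
have [||F [Fm Fc] /(_ _ erefl)] := @ultra_exists [set meet x (compl y)] _ erefl.
- by move=> _ _ -> ->; exact: meetxx.
- by move=> /esym.
by rewrite Fm Fc; exists F.
Qed.

End BooleanAlgebra.

(** * Representation over the monoid of finitary maps *)

Section GeneratedVariety.
Variable I : eqType.

(** Taking composites of generators gives every point a word that acts on the algebra. *)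
Definition word_space : set (I -> I) := range (@word_fun I).

Lemma word_space_weak : word_space `<=` @weak_space I.
Proof.
move=> _ [w _ <-]; elim: w => [|g w IHw] /=.
  by apply: (sub_finite_set _ (finite_set0 I)) => i /=.
pose p := val (gen_pair g).
(* Composing with [g] can move only the indices moved by [w] and the two indices of [g]. *)
have hf : finite_set ([set i | word_fun w i <> i] `|` [set p.1; p.2]).
  by rewrite finite_setU; split=> //; exact: finite_set2.
apply: sub_finite_set hf => i /= gi; apply: contrapT => hi; apply: gi.
have -> : word_fun w i = i by apply: contrapT => wi; apply: hi; left.
have ip1 : (i == p.1) = false by apply/eqP => ip; apply: hi; right; left.
have ip2 : (i == p.2) = false by apply/eqP => ip; apply: hi; right; right.
by move: ip1 ip2; rewrite /p; case: (g) => q /= -> // ->.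
Qed.

Lemma word_space_square : locally_square word_space.
Proof.
move=> _ [w _ <-] g; exists (w ++ [:: g]) => //.
by apply/funext => i; rewrite word_fun_cat.
Qed.

(* As [F (act w a)] only depends on [word_fun w], an ultrafilter F gives the
   homomorphism a |-> {q | q.a is in F}. *)
Lemma is_SA_generated_variety (A : algebra I) (L : algebra I -> Prop) :
  is_SA A -> variety L -> L (power_algebra word_space) -> L A.
Proof.
move=> hA [_ Lsub Lprod] LV.
pose T := {F : A -> Prop | is_ultra F}.
pose rep (F : T) a : set (I -> I) :=
  [set q | exists2 w, word_fun w = q & sval F (act w a)].
have repE F a w : rep F a (word_fun w) <-> sval F (act w a).
  split=> [[u uw]|]; last by exists w.
  by rewrite (SA_act hA (u := u) (v := w)) // uw.
have repV F a : rep F a `<=` word_space by move=> q [w <- _]; exists w.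
pose f a : prod_algebra (fun _ : T => power_algebra word_space) :=
  fun F => power_elt (repV F a).
have V_ext (X Y : power_algebra word_space) :
    (forall w, sval X (word_fun w) <-> sval Y (word_fun w)) -> X = Y.
  case: X Y => [X XV] [Y YV] /= XY; apply: eq_exist; apply/seteqP.
  split=> q Xq.
    by have [w _ wq] := XV _ Xq; move: Xq; rewrite -wq XY.
  by have [w _ wq] := YV _ Xq; move: Xq; rewrite -wq XY.
apply: (Lsub A _ f); last by apply: Lprod => _.
split; last first.
  move=> x y fxy.
  have le u v : f u = f v -> leA u v.
    move=> fuv; apply: contrapT => /(ultra_separation hA) [F hF [Fu]].
    have [F' F'E] : exists F' : T, sval F' = F by exists (exist _ F hF).
    have repuv : rep F' u = rep F' v.
      by have := congr1 (fun X => sval (X F')) fuv.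
    (* The empty word denotes the identity map, which lies in [rep F' u] exactly when [F'] contains
       [u]. *)
    have := repE F' v [::]; rewrite -repuv repE /= F'E => uv.
    by move=> Fv; apply/Fv/uv.
  by apply: (leA_anti hA); exact: le.
have hact (F : T) w := ultra_act hA w (proj2_sig F).
split=> [x y|x|g x]; apply: functional_extensionality_dep => F;
    apply: V_ext => w /=; rewrite !repE.
- exact: (hact F w).1.
- rewrite (hact F w).2; split=> [?|[]//]; split=> //; by exists w.
(* Applying [sub g] before [w] appends [g] to the word, which composes the point with [gen_fun g] on
   the right. *)
rewrite -(act_cat w [:: g]) -repE.
have -> : word_fun (w ++ [:: g]) = word_fun w \o gen_fun g.
  by apply/funext => i; rewrite word_fun_cat.
by split=> [|[]//]; split=> //; exists w.
Qed.

End GeneratedVariety.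

(** * Lifting ultrafilters and the superamalgam *)

Section Amalgamation.
Variable I : eqType.

Lemma hom_bot (A B : algebra I) (f : A -> B) : is_SA B ->
  is_hom f -> f (bot A) = bot B.
Proof. by move=> hB [fm fc _]; rewrite {1}/bot fm fc meetxN. Qed.

Lemma ultra_preim (A B : algebra I) (f : A -> B) (F : B -> Prop) :
  is_hom f -> is_ultra F -> is_ultra (F \o f).
Proof. by move=> [fm fc _] [Fm Fc]; split=> [x y|x] /=; rewrite ?fm ?fc. Qed.

(** The elements [meet (f z) x] with [z] in [F] form a filter base. The trace on [A] of an
    ultrafilter above it contains [F], and inclusion between ultrafilters is equality. *)
Lemma ultra_lift (A B : algebra I) (f : A -> B) (F : A -> Prop) (x : B) :
  is_SA B -> is_hom f -> is_ultra F ->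
  (forall z, F z -> meet (f z) x <> bot B) ->
  exists2 G, is_ultra G & G x /\ G \o f = F.
Proof.
move=> hB [fm fc _] [Fm Fc] Fx.
have [a Fa] : exists a, F a.
  have a := inhabited_witness (carrier_inhabited A).
  by have [|/Fc] := EM (F a); [exists a|exists (compl a)].
have [|||G hG BG] := @ultra_exists _ _ hB [set meet (f z) x | z in F] (meet (f a) x).
- by exists a.
- move=> _ _ [z Fz <-] [z' Fz' <-]; exists (meet z z'); first exact/Fm.
  by rewrite fm -!(meetA hB) [meet x (meet _ _)](meetA hB) (meetC hB x)
    -(meetA hB) (meetxx hB).
- by move=> [z Fz] /Fx.
have Gf z : F z -> G (f z) /\ G x.
  by move=> Fz; apply/hG.1; apply: BG; exists z.
exists G => //; split; first exact: (Gf a Fa).2.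
apply/funext => z; apply/propext; split=> [Gz|/Gf[]//].
apply: contrapT => /Fc /Gf [+ _]; rewrite fc.
by move/hG.2; apply.
Qed.

(** The case of [ultra_lift] where [x] is the unit; its condition then follows from injectivity of
    [f]. *)
Lemma ultra_extend (A B : algebra I) (f : A -> B) (F : A -> Prop) :
  is_SA A -> is_SA B -> is_embedding f -> is_ultra F ->
  exists2 G, is_ultra G & G \o f = F.
Proof.
move=> hA hB [fh f_inj] hF.
have [|G hG [_ GF]] := ultra_lift (x := compl (bot B)) hB fh hF; last by exists G.
move=> z Fz; suff -> : meet (f z) (compl (bot B)) = f z.
  by rewrite -(hom_bot hB fh) => /f_inj zb; apply: (ultra_bot hF); rewrite -zb.
by apply/(leA_bot hB); rewrite (complK hB) (meetxbot hB).
Qed.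

(* If no z interpolates, then {i2 z | x <= i1 z} together with -y generates a
   proper filter, and an ultrafilter F2 containing it has a trace on A0 that is
   compatible with x. *)
Lemma ultra_interpolation (A0 A1 A2 : algebra I) (i1 : A0 -> A1) (i2 : A0 -> A2)
    (x : A1) (y : A2) :
  is_SA A1 -> is_SA A2 -> is_hom i1 -> is_hom i2 ->
  ~ (exists z, leA x (i1 z) /\ leA (i2 z) y) ->
  exists F1 F2, [/\ is_ultra F1, is_ultra F2, F1 \o i1 = F2 \o i2, F1 x & ~ F2 y].
Proof.
move=> h1 h2 i1h i2h hxy; have [i1m i1c _] := i1h; have [i2m i2c _] := i2h.
pose B := [set meet (i2 z) (compl y) | z in [set z | leA x (i1 z)]].
(* The unit witnesses that [B] is nonempty. *)
pose top := compl (bot A0).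
have xtop : leA x (i1 top).
  by apply/(leA_bot h1); rewrite i1c (complK h1) (hom_bot h1) // (meetxbot h1).
have [|||F2 hF2 BF] := @ultra_exists _ _ h2 B (meet (i2 top) (compl y)).
- by exists top.
- move=> _ _ [z xz <-] [z' xz' <-]; exists (meet z z').
    by rewrite /= i1m -(meetxx h1 x); exact: (leA_meet h1).
  by rewrite i2m -!(meetA h2) [meet (compl y) (meet _ _)](meetA h2)
    (meetC h2 (compl y)) -(meetA h2) (meetxx h2).
- by move=> [z xz /(leA_bot h2) zy]; apply: hxy; exists z.
have F2z z : leA x (i1 z) -> F2 (i2 z) /\ F2 (compl y).
  by move=> xz; apply/hF2.1; apply: BF; exists z.
have [|F1 hF1 [F1x F12]] := ultra_lift (x := x) h1 i1h (ultra_preim i2h hF2).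
  (* Were [meet (i1 z) x] zero, [x] would lie below [i1 (compl z)], and [F2] would contain both
     [i2 z] and its complement. *)
  move=> z F2iz zx; have [|+ _] := F2z (compl z).
    by apply/(leA_bot h1); rewrite i1c (complK h1) (meetC h1).
  by rewrite i2c => /hF2.2; apply.
exists F1, F2; split=> //.
by apply/hF2.2; exact: (F2z _ xtop).2.
Qed.

Variables (A0 A1 A2 : algebra I) (i1 : A0 -> A1) (i2 : A0 -> A2).
Hypotheses (h0 : is_SA A0) (h1 : is_SA A1) (h2 : is_SA A2).
Hypotheses (i1e : is_embedding i1) (i2e : is_embedding i2).

Definition matched (F : (A1 -> Prop) * (A2 -> Prop)) : Prop :=
  [/\ is_ultra F.1, is_ultra F.2 & F.1 \o i1 = F.2 \o i2].

Lemma matched_sub (F : (A1 -> Prop) * (A2 -> Prop)) (g : gen I) :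
  matched F -> matched (F.1 \o sub g, F.2 \o sub g).
Proof.
have [[[_ _ i1s] _] [[_ _ i2s] _]] := (i1e, i2e).
move=> [F1 F2 F12]; split; [exact: (ultra_act h1 [:: g])|exact: (ultra_act h2 [:: g])|].
apply/funext => z /=; rewrite -i1s -i2s.
by have := congr1 (fun f => f (sub g z)) F12.
Qed.

Definition matched_act (F : {F | matched F}) (g : gen I) : {F | matched F} :=
  exist _ _ (matched_sub g (proj2_sig F)).

Definition amalgam : algebra I :=
  {| carrier := {F | matched F} -> Prop;
     carrier_inhabited := inhabits (fun=> True);
     meet := fun X Y F => X F /\ Y F;
     compl := fun X F => ~ X F;
     sub := fun g X F => X (matched_act F g) |}.

(** A word moves a pair of ultrafilters by precomposition with its action on [A1] and [A2], so words
    denoting the same map move it equally. *)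
Lemma is_SA_amalgam : is_SA amalgam.
Proof.
apply: (@is_SA_points I amalgam {F | matched F} (fun X F => X F) matched_act) => //.
move=> u v uv F.
have sval_ext (G H : {F | matched F}) : sval G = sval H -> G = H.
  by case: G H => [G hG] [H hH] /= GH; exact: eq_exist.
apply: sval_ext.
have hact w G : sval (foldl matched_act G w) =
    ((sval G).1 \o act w, (sval G).2 \o act w).
  elim: w G => [[[F1 F2] hF] //|g w IHw G /=]; exact: IHw.
by rewrite !hact; congr pair; apply/funext => x /=; rewrite (SA_act _ uv).
Qed.

Definition amalgam_in1 (x : A1) : amalgam := fun F => (sval F).1 x.
Definition amalgam_in2 (y : A2) : amalgam := fun F => (sval F).2 y.

(** For injectivity, an ultrafilter of [A1] separating two elements has a trace on [A0] that extends
    along [i2], which completes it to a matched pair. *)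
Lemma amalgam_in1_embedding : is_embedding amalgam_in1.
Proof.
split.
  by split=> [x y|x|//]; apply/funext => -[F [F1 F2 F12]];
    apply/propext; rewrite /amalgam_in1 /= ?F1.1 ?F1.2.
suff le x y : amalgam_in1 x = amalgam_in1 y -> leA x y.
  by move=> x y xy; apply: (leA_anti h1); exact: le.
move=> xy; apply: contrapT => /(ultra_separation h1) [F1 hF1 [F1x]]; apply.
have [F2 hF2 F12] := ultra_extend h0 h2 i2e (ultra_preim i1e.1 hF1).
have mF : matched (F1, F2) by split.
have : amalgam_in1 x (exist _ _ mF) by [].
by rewrite xy.
Qed.

Lemma amalgam_in2_embedding : is_embedding amalgam_in2.
Proof.
split.
  by split=> [x y|x|//]; apply/funext => -[F [F1 F2 F12]];
    apply/propext; rewrite /amalgam_in2 /= ?F2.1 ?F2.2.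
suff le x y : amalgam_in2 x = amalgam_in2 y -> leA x y.
  by move=> x y xy; apply: (leA_anti h2); exact: le.
move=> xy; apply: contrapT => /(ultra_separation h2) [F2 hF2 [F2x]]; apply.
have [F1 hF1 F12] := ultra_extend h0 h1 i1e (ultra_preim i2e.1 hF2).
have mF : matched (F1, F2) by split.
have : amalgam_in2 x (exist _ _ mF) by [].
by rewrite xy.
Qed.

Lemma amalgam_in_eq a : amalgam_in1 (i1 a) = amalgam_in2 (i2 a).
Proof.
apply/funext => F; have [_ _ F12] := proj2_sig F.
by have := congr1 (fun f => f a) F12.
Qed.

(** Without an interpolant, [ultra_interpolation] yields a matched pair that lies in the image of
    [x] but not in that of [y]. *)
Lemma amalgam_interpolation12 x y : leA (amalgam_in1 x) (amalgam_in2 y) ->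
  exists z, leA x (i1 z) /\ leA (i2 z) y.
Proof.
move=> xy; apply: contrapT => /(ultra_interpolation h1 h2 i1e.1 i2e.1).
move=> [F1 [F2 [hF1 hF2 F12 F1x]]]; apply.
have mF : matched (F1, F2) by split.
have : amalgam_in1 x (exist _ _ mF) by [].
by rewrite -xy => -[].
Qed.

Lemma amalgam_interpolation21 x y : leA (amalgam_in2 x) (amalgam_in1 y) ->
  exists z, leA x (i2 z) /\ leA (i1 z) y.
Proof.
move=> xy; apply: contrapT => /(ultra_interpolation h2 h1 i2e.1 i1e.1).
move=> [F2 [F1 [hF2 hF1 F21 F2x]]]; apply.
have mF : matched (F1, F2) by split.
have : amalgam_in2 x (exist _ _ mF) by [].
by rewrite -xy => -[].
Qed.

End Amalgamation.

(** * Assembly of the two claims *)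

(** Supplies the two indices that every finite reindexing includes. *)
Lemma infinite_setT_distinct (T : eqType) :
  infinite_set [set: T] -> exists a b : T, a != b.
Proof.
move=> Tinf; apply: contrapT => hT; apply: Tinf.
have [[a _]|hn] := pselect (exists a : T, True).
  apply: sub_finite_set (finite_set1 a) => b _ /=.
  by apply: contrapT => /eqP ba; apply: hT; exists b, a.
by apply: sub_finite_set (finite_set0 T) => b _ /=; apply: hn; exists b.
Qed.

Theorem theorem3p26 (d : Order.disp_t) (alpha : orderType d)
    (alpha_wf : well_founded (fun i j : alpha => (i < j)%O))
    (alpha_infinite : infinite_set (@setT alpha))
    (R : forall n : nat, seq (word 'I_n * word 'I_n))
    (R_presents : forall n : nat, (2 <= n)%N -> presents (R n)) :
  (forall A : algebra alpha, WSA A <-> SA R A) /\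
  superamalgamation (fun A : algebra alpha => SA R A).
Proof.
have [a [b ab]] := infinite_setT_distinct alpha_infinite.
have SAP (A : algebra alpha) : SA R A <-> is_SA A.
  by split; [exact: (SA_is_SA R_presents ab)|exact: is_SA_SA].
split=> [A|A0 A1 A2 i1 i2 /SAP h0 /SAP h1 /SAP h2 i1e i2e].
  split=> [|/SAP hA L hL LV].
    (* [SA] is itself a variety containing the generating power algebras, so it contains the variety
       they generate. *)
    apply; first exact: variety_SA.
    by move=> _ [V [_ hV ->]]; apply/SAP; exact: is_SA_power_algebra.
  apply: (is_SA_generated_variety hA hL); apply: LV.
  exists (@word_space alpha); split=> //; first exact: word_space_weak.
  exact: word_space_square.
exists (amalgam h1 h2 i1e i2e).
exists (@amalgam_in1 _ _ _ _ _ _ h1 h2 i1e i2e).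
exists (@amalgam_in2 _ _ _ _ _ _ h1 h2 i1e i2e).
split; first split.
- by apply/SAP; exact: is_SA_amalgam.
- exact: amalgam_in1_embedding.
- exact: amalgam_in2_embedding.
- exact: amalgam_in_eq.
split; first exact: amalgam_interpolation12.
exact: amalgam_interpolation21.
Qed.
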